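(* Let $n\geq 2$, and let $\Sigma$ be a graph, $G\leq\mathrm{Aut}(\Sigma)$, and $N\lhd G$. Then the following are equivalent. (a) $\Sigma$ is a $(G,2)$-arc-transitive $N$-normal cover of $\mathbf{K}_{2^n,2^n}$, and $\mathbf{K}_{2^n,2^n}$ (that is, the quotient $\Sigma_N\cong\mathbf{K}_{2^n,2^n}$) is $G/N$-edge-affine. (b) $G$ has a normal subgroup $H$ with derived subgroup $H'=N$ such that, for some subgroups $X,Y$ of $H$, $H$ is an $n$-dimensional mixed dihedral group relative to $X$ and $Y$, the line graph of $\Sigma$ is $C(H,X,Y)$ (where the given action of the subgroup $H\leq G$ on the vertices of the line graph, i.e. on $E(\Sigma)$, is identified with the right multiplication action of $H$ on the vertex set $H$ of $C(H,X,Y)$), and $C(H,X,Y)$ is $G$-edge-transitive (with $G$ acting on the line graph of $\Sigma$ in the natural way).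
   Context: All graphs are finite, connected, simple and undirected. $\mathbf{K}_{2^n,2^n}$ is the complete bipartite graph. A $2$-arc of a graph is a triple $(u,v,w)$ of vertices with $u\neq w$ and $\{u,v\},\{v,w\}$ edges. For $G\leq\mathrm{Aut}(\Sigma)$, $\Sigma$ is $(G,2)$-arc-transitive if $G$ is transitive on the set of all $2$-arcs; a graph is $G$-edge-transitive if $G$ acts on it as automorphisms and is transitive on its edges. For $N\lhd G\leq \mathrm{Aut}(\Sigma)$ with $G$ transitive on $V(\Sigma)$, the $N$-normal quotient $\Sigma_N$ has as vertices the $N$-orbits in $V(\Sigma)$, two distinct $N$-orbits being adjacent if some edge of $\Sigma$ has one end in each. $\Sigma$ is an $N$-normal cover of a graph $\Delta$ if $\Sigma_N\cong\Delta$ and $\Sigma$, $\Delta$ have the same valency. $\mathbf{K}_{2^n,2^n}$ is $L$-edge-affine if $L\leq S_{2^n}\wr S_2=\mathrm{Aut}(\mathbf{K}_{2^n,2^n})$ and $L$ has a normal subgroup isomorphic to $C_2^n\times C_2^n$ that is intransitive on vertices and regular on edges; here $G/N$ is considered in its induced (faithful) action on $\Sigma_N$. A finite group $H$ with subgroups $X,Y$ is an $n$-dimensional mixed dihedral group relative to $X$ and $Y$ if $X\cong Y\cong C_2^n$, $H=\langle X\cup Y\rangle$ and $H/H'\cong C_2^{2n}$, where $H'$ is the derived subgroup. For an inverse-closed subset $S\subseteq H\setminus\{1\}$, $\mathrm{Cay}(H,S)$ is the graph with vertex set $H$ and edges $\{g,sg\}$ ($g\in H$, $s\in S$); $H$ acts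 on it by right multiplication as a regular group of automorphisms. For an $n$-dimensional mixed dihedral group $H$ relative to subgroups $X$ and $Y$, $C(H,X,Y)=\mathrm{Cay}(H,(X\cup Y)\setminus\{1\})$. The line graph of $\Sigma$ has vertex set $E(\Sigma)$, two distinct edges being adjacent when they share a vertex. *)

(* Defs.v *)
From HB Require Import structures.
From mathcomp Require Import all_boot all_order all_algebra all_fingroup.
From mathcomp Require Import all_solvable.

Set Implicit Arguments.
Unset Strict Implicit.
Unset Printing Implicit Defensive.

Import GroupScope.

Record sgraph := SGraph {
  svertex :> finType;
  adj : rel svertex;
  adj_sym : symmetric adj;
  adj_irrefl : irreflexive adj }.

Definition connected_graph (Gm : sgraph) : Prop :=
  forall x y : Gm, connect (@adj Gm) x y.

Definition edges (Gm : sgraph) : {set {set Gm}} :=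
  [set [set p.1; p.2] | p : Gm * Gm & adj p.1 p.2].

Definition has_valency (k : nat) (Gm : sgraph) : Prop :=
  forall x : Gm, #|[set y | adj x y]| = k.

Definition is_graph_iso (Gm Dl : sgraph) (f : Gm -> Dl) : Prop :=
  bijective f /\ forall x y, adj (f x) (f y) = adj x y.

Definition graph_isomorphic (Gm Dl : sgraph) : Prop :=
  exists f : Gm -> Dl, is_graph_iso f.

Section Automorphisms.
Variable Gm : sgraph.

Definition graph_aut : {set {perm Gm}} :=
  [set p : {perm Gm} | [forall x, forall y, adj (p x) (p y) == adj x y]].

Lemma graph_aut_group_set : group_set graph_aut.
Proof.
apply/group_setP; split=> [|p q].
  by rewrite inE; apply/forallP=> x; apply/forallP=> y; rewrite !perm1.
rewrite !inE => /'forall_'forall_eqP pP /'forall_'forall_eqP qP.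
by apply/'forall_'forall_eqP=> x y; rewrite !permM qP pP.
Qed.
Canonical graph_aut_group := Group graph_aut_group_set.

End Automorphisms.

(* Groups are allowed to act on a graph through an arbitrary (partial) action *)
(* of MathComp; acts_as_auts includes that the action is defined on L.        *)
Definition acts_as_auts (aT : finGroupType) (D : {group aT}) (Gm : sgraph)
    (to : action D Gm) (L : {set aT}) : Prop :=
  L \subset D /\ {in L, forall a, forall x y, adj (to x a) (to y a) = adj x y}.

Definition edge_transitive (aT : finGroupType) (D : {group aT}) (Gm : sgraph)
    (to : action D Gm) (L : {set aT}) : Prop :=
  acts_as_auts to L /\ [transitive L, on edges Gm | to^*].

Definition edge_regular (aT : finGroupType) (D : {group aT}) (Gm : sgraph)
    (to : action D Gm) (L : {set aT}) : Prop :=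
  edge_transitive to L /\ {in edges Gm, forall E, 'C_L[E | to^*] = 1}.

Definition is_2arc (Gm : sgraph) (u v w : Gm) : bool :=
  [&& u != w, adj u v & adj v w].

Definition two_arc_transitive (Gm : sgraph) (G : {set {perm Gm}}) : Prop :=
  G \subset graph_aut Gm /\
  forall u v w u' v' w' : Gm, is_2arc u v w -> is_2arc u' v' w' ->
    exists2 g, g \in G & [/\ g u = u', g v = v' & g w = w'].

Section CompleteBipartite.
Variables a b : nat.

Definition bip_adj : rel ('I_a + 'I_b)%type := fun x y =>
  match x, y with
  | inl _, inr _ | inr _, inl _ => true
  | _, _ => false
  end.

Lemma bip_adj_sym : symmetric bip_adj. Proof. by case=> ? []. Qed.
Lemma bip_adj_irrefl : irreflexive bip_adj. Proof. by case. Qed.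

Definition complete_bipartite : sgraph := SGraph bip_adj_sym bip_adj_irrefl.

End CompleteBipartite.

Section NormalQuotient.
Variables (Gm : sgraph) (N : {group {perm Gm}}).

Definition orbits : {set {set Gm}} := orbit 'P N @: [set: Gm].

Definition quotient_vertex : finType := {B : {set Gm} | B \in orbits}.

Definition quotient_adj : rel quotient_vertex := fun B C =>
  (B != C) && [exists x in val B, exists y in val C, adj x y].

Lemma quotient_adj_sym : symmetric quotient_adj.
Proof.
move=> B C; rewrite /quotient_adj eq_sym; congr (_ && _).
by apply/exists_inP/exists_inP=> -[x xB /exists_inP[y yC xy]];
  exists y => //; apply/exists_inP; exists x; rewrite // adj_sym.
Qed.

Lemma quotient_adj_irrefl : irreflexive quotient_adj.
Proof. by move=> B; rewrite /quotient_adj eqxx. Qed.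

Definition normal_quotient : sgraph :=
  SGraph quotient_adj_sym quotient_adj_irrefl.

(* The action of cosets of N on N-orbits induced by permutations of the       *)
(* vertices: the set action, passed to the quotient modulo N (which fixes     *)
(* every N-orbit) and restricted to the set of N-orbits.                      *)
Definition normal_quotient_action :
    action (subact_dom (fun B => B \in orbits) ('P^* %% N)%act) normal_quotient :=
  (('P^* %% N)^?)%act.

End NormalQuotient.

Arguments normal_quotient_action {Gm} N.

Definition normal_cover (Gm : sgraph) (G N : {group {perm Gm}})
    (Dl : sgraph) : Prop :=
  [/\ [transitive G, on [set: Gm] | 'P],
      graph_isomorphic (normal_quotient N) Dl
    & exists k, has_valency k Gm /\ has_valency k Dl].

(* C2pow m is the group C_2^m, as the additive group of F_2^m. *)
Definition C2pow (m : nat) : {group 'rV['F_2]_m} := [set: 'rV['F_2]_m]%G.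

(* The first two clauses say that L, through the action to, is a subgroup of  *)
(* the automorphism group of K; this is used with K a copy of K_{2^n,2^n}.    *)
Definition edge_affine (n : nat) (aT : finGroupType) (D : {group aT})
    (K : sgraph) (to : action D K) (L : {group aT}) : Prop :=
  [/\ acts_as_auts to L,
      [faithful L, on [set: K] | to]
    & exists M : {group aT},
      [/\ M <| L,
          M \isog setX (C2pow n) (C2pow n),
          ~~ [transitive M, on [set: K] | to]
        & edge_regular to M]].

Section LineGraph.
Variable Gm : sgraph.

Definition line_vertex : finType := {E : {set Gm} | E \in edges Gm}.

Definition line_adj : rel line_vertex := fun E F =>
  (E != F) && (val E :&: val F != set0).

Lemma line_adj_sym : symmetric line_adj.
Proof. by move=> E F; rewrite /line_adj eq_sym setIC. Qed.

Lemma line_adj_irrefl : irreflexive line_adj.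
Proof. by move=> E; rewrite /line_adj eqxx. Qed.

Definition line_graph : sgraph := SGraph line_adj_sym line_adj_irrefl.

(* The natural action on edges; its domain consists of the permutations of    *)
(* the vertices that preserve the edge set, and so contains graph_aut Gm.     *)
Definition line_action :
    action (subact_dom (fun E => E \in edges Gm) ('P^*)%act) line_graph :=
  ('P^*^?)%act.

End LineGraph.

Arguments line_action Gm : clear implicits.

Section Cayley.
Variables (gT : finGroupType) (H : {group gT}) (S : {set gT}).
Hypotheses (S1 : 1 \notin S) (SV : S^-1 = S).

Definition cay_adj : rel (subg_of H) := fun g h =>
  [exists s in S, sgval h == s * sgval g].

Lemma cay_adj_sym : symmetric cay_adj.
Proof.
by move=> g h; apply/exists_inP/exists_inP=> -[s Ss /eqP->];
  exists s^-1; rewrite ?mulKg // -SV inE invgK.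
Qed.

Lemma cay_adj_irrefl : irreflexive cay_adj.
Proof.
move=> g; apply/exists_inP=> -[s Ss]; rewrite eq_sym eq_mulgV1 mulgK => /eqP s1.
by case/negP: S1; rewrite -s1.
Qed.

Definition cayley_graph : sgraph := SGraph cay_adj_sym cay_adj_irrefl.

End Cayley.

Section MixedDihedral.
Variables (gT : finGroupType) (H X Y : {group gT}).

Definition mixed_dihedral (n : nat) : Prop :=
  [/\ X \subset H /\ Y \subset H,
      X \isog C2pow n /\ Y \isog C2pow n,
      H :=: <<X :|: Y>>
    & H / H^`(1) \isog C2pow (2 * n)%N].

Lemma notin1_conn : 1 \notin (X :|: Y)^#.
Proof. by rewrite !inE eqxx. Qed.

Lemma conn_inv : ((X :|: Y)^#)^-1 = (X :|: Y)^#.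
Proof. by apply/setP=> x; rewrite !inE invg_eq1 !groupV. Qed.

Definition mixed_dihedral_graph : sgraph :=
  cayley_graph H notin1_conn conn_inv.

End MixedDihedral.

(* The line graph of Gm is C(H,X,Y), the action of H on edges being identified *)
(* with right multiplication.                                                  *)
Definition line_graph_is_mixed_dihedral (Gm : sgraph)
    (H X Y : {group {perm Gm}}) : Prop :=
  exists phi : mixed_dihedral_graph H X Y -> line_graph Gm,
    is_graph_iso phi /\
    forall g h : subg_of H, phi (g * h) = line_action Gm (phi g) (sgval h).

(* Main.v *)
Require Import Defs.
From mathcomp Require Import all_boot all_order all_algebra all_fingroup.
From mathcomp Require Import all_solvable.
From mathcomp Require Import mxabelem.

(* Both conditions say that G has a normal subgroup H containing N which acts *)
(* regularly on the edges of Sigma and preserves its two sides. Then H is     *)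
(* generated by the stabilisers X and Y of the ends u, v of an edge, h |->    *)
(* {u^h, v^h} identifies H with the vertices of the line graph, and edges     *)
(* g and h meet iff h g^-1 lies in X or Y.                                    *)
(* From (a), H is the preimage of the edge-regular normal subgroup of G / N:  *)
(* equal valencies make the quotient map a covering, along which regularity   *)
(* lifts. H / H' is generated by two groups of order 2^n, so H' is no smaller *)
(* than N. From (b), the stars of u and v are cliques of C(H,X,Y), hence are  *)
(* X and Y; the N-orbits are indexed by X and Y as H = XYN with H / N the     *)
(* direct product of the images of X and Y, and an involution of X reverses   *)
(* a 2-arc centred at u.                                                      *)

Set Implicit Arguments.
Unset Strict Implicit.
Unset Printing Implicit Defensive.

Import GroupScope.

(** * Normal quotients and covers *)

(** The common ground of the two conditions is [edge_frame]: H moves the edge {u,v} onto every edge,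
    only the identity fixes this edge setwise, and no element takes u to v. Write X and Y for the
    stabilisers in H of u and v. Connectedness gives H = <X,Y> ([frame_gen]), and two edges meet
    exactly when they share their images of u or their images of v, so the line graph is a Cayley
    graph ([frame_line_graph]). For (a) to (b), [cover_frame] lifts edge-regularity along the
    covering, and an order count identifies N with H' ([mixed_dihedral_of_quotient]). For (b) to
    (a), [line_graph_frame] recovers u and v from the cliques of the Cayley graph. As xy and yx
    agree modulo H', every orbit on one side is adjacent to every orbit on the other
    ([frame_quotient]). An edge of the line graph is a 2-arc up to reversal, so 2-arc-transitivity
    of G needs only one reversing element ([frame_two_arc_transitive]), and [frame_edge_affine]
    shows that H / N is the required subgroup. *)

Lemma set2_inj (T : finType) (a b c d : T) :
  [set a; b] = [set c; d] -> (a = c /\ b = d) \/ (a = d /\ b = c).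
Proof.
move=> E; have := set21 a b; have := set22 a b; have := set21 c d.
have := set22 c d; rewrite {1 2}E -{1 2}E !inE.
by do 4![case/orP=> /eqP ?]; subst; auto.
Qed.

Lemma imset_set2 (aT rT : finType) (f : aT -> rT) a b :
  f @: [set a; b] = [set f a; f b].
Proof. by rewrite imsetU !imset_set1. Qed.

Lemma connect_ind (T : finType) (e : rel T) (P : T -> Prop) (x y : T) :
  P x -> (forall a b, P a -> e a b -> P b) -> connect e x y -> P y.
Proof.
move=> Px Pe /connectP[p + ->]; elim: p x Px => //= z p IHp x Px /andP[xz].
exact/IHp/(Pe x).
Qed.

Lemma sub_graph_autP (Gm : sgraph) (g : {perm Gm}) :
  reflect (forall x y, adj (g x) (g y) = adj x y) (g \in graph_aut Gm).
Proof. by rewrite inE; apply: 'forall_'forall_eqP. Qed.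

Lemma edgesP (Gm : sgraph) (E : {set Gm}) :
  reflect (exists x y, adj x y /\ E = [set x; y]) (E \in edges Gm).
Proof.
apply: (iffP imsetP) => [[[x y]]|[x [y [xy ->]]]].
  by rewrite inE /= => xy ->; exists x, y.
by exists (x, y); rewrite ?inE.
Qed.

Lemma edges_pair (Gm : sgraph) (x y : Gm) :
  ([set x; y] \in edges Gm) = adj x y.
Proof.
apply/edgesP/idP => [[a [b [ab /set2_inj[] [-> ->]]]]|xy] //.
  by rewrite adj_sym.
by exists x, y.
Qed.

Section Quotient.
Variables (Gm : sgraph) (N : {group {perm Gm}}).

Fact qvert_subproof (x : Gm) : orbit 'P N x \in orbits N.
Proof. exact: imset_f. Qed.

Definition qvert (x : Gm) : normal_quotient N :=
  exist (fun B => B \in orbits N) _ (qvert_subproof x).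

Lemma qvert_surj (B : normal_quotient N) : exists x, B = qvert x.
Proof.
case: B => B BN; have /imsetP[x _ BE] := BN.
by exists x; apply: val_inj.
Qed.

Lemma qvertP x y : reflect (exists2 n, n \in N & n x = y) (qvert y == qvert x).
Proof.
rewrite -val_eqE /= orbit_eq_mem; apply: (iffP orbitP) => [] [n nN nx];
  by exists n.
Qed.

Lemma qvert_act n x : n \in N -> qvert (n x) = qvert x.
Proof. by move=> nN; apply/eqP/qvertP; exists n. Qed.

Lemma mem_qvert x y : (y \in val (qvert x)) = (qvert y == qvert x).
Proof. by rewrite -val_eqE /= orbit_eq_mem. Qed.

Hypothesis N_aut : N \subset graph_aut Gm.

(** An edge between the two orbits can be moved by N until its first end is x. *)
Lemma adj_qvert_lift x y :
  adj (qvert x) (qvert y) -> exists2 z, adj x z & qvert z = qvert y.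
Proof.
case/andP=> _ /exists_inP[a + /exists_inP[b + ab]].
rewrite !mem_qvert => /qvertP[n nN an] /eqP yb.
have /sub_graph_autP nP := subsetP N_aut n nN.
exists (n^-1 b); last by rewrite -yb qvert_act ?groupV.
by rewrite -nP permKV an.
Qed.

Lemma adj_qvert x y : adj x y -> qvert x != qvert y -> adj (qvert x) (qvert y).
Proof.
move=> xy neq; apply/andP; split=> //; apply/exists_inP; exists x.
  by rewrite mem_qvert.
by apply/exists_inP; exists y; rewrite // mem_qvert.
Qed.

Lemma setact_qvert g x : g \in 'N(N) ->
  ('P^*)%act (val (qvert x)) g = val (qvert (g x)).
Proof. by move=> /normP gN; rewrite /= setact_orbit gN. Qed.

(** The action ['P^* %% N] is computed by the set action only at points fixed by N, whence this
    check. *)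
Lemma qvert_fix x : val (qvert x) \in 'Fix_(('P^*)%act)(setT :&: N).
Proof.
apply/afixP=> n /setIP[_ nN]; rewrite setact_qvert ?(subsetP (normG N)) //.
by rewrite qvert_act.
Qed.

Lemma modact_qvert g x : g \in 'N(N) ->
  ('P^* %% N)%act (val (qvert x)) (coset N g) = val (qvert (g x)).
Proof. by move=> gN; rewrite /= modactE ?qvert_fix ?in_setT ?setact_qvert. Qed.

Lemma quotient_action_dom g : g \in 'N(N) ->
  coset N g \in subact_dom (fun B => B \in orbits N) ('P^* %% N)%act.
Proof.
move=> gN; rewrite /subact_dom inE mem_quotient ?inE //=.
apply/subsetP=> B; rewrite !inE => /imsetP[x _ ->].
by have /= -> := modact_qvert x gN; apply: imset_f.
Qed.

Lemma quotient_actionE g x : g \in 'N(N) ->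
  normal_quotient_action N (qvert x) (coset N g) = qvert (g x).
Proof.
move=> gN; apply: val_inj; rewrite val_subact quotient_action_dom //.
exact: modact_qvert.
Qed.

Section Cover.
Hypothesis Gm_conn : connected_graph Gm.
Variable k : nat.
Hypothesis (Gm_val : has_valency k Gm) (q_val : has_valency k (normal_quotient N)).

(* A neighbour of x lies over each of the k neighbours of its orbit, and x    *)
(* has only k neighbours.                                                     *)
Lemma cover_nbrs x :
  {in [set y | adj x y] &, injective qvert} /\
  [set B | adj (qvert x) B] = qvert @: [set y | adj x y].
Proof.
have sub : [set B | adj (qvert x) B] \subset qvert @: [set y | adj x y].
  apply/subsetP=> B; rewrite inE; have [y ->] := qvert_surj B.
  by move=> /adj_qvert_lift[z xz <-]; rewrite imset_f ?inE.
have le : (#|qvert @: [set y | adj x y]| <= #|[set B | adj (qvert x) B]|)%N.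
  by rewrite q_val (leq_trans (leq_imset_card _ _)) ?Gm_val.
split; last by apply/eqP; rewrite eqEcard sub.
apply/imset_injP/eqP; rewrite Gm_val -(q_val (qvert x)).
by apply: anti_leq; rewrite le subset_leq_card.
Qed.

Lemma cover_inj x y z : adj x y -> adj x z -> qvert y = qvert z -> y = z.
Proof. by move=> xy xz; apply: (proj1 (cover_nbrs x)); rewrite inE. Qed.

Lemma cover_adj x y : adj x y -> adj (qvert x) (qvert y).
Proof.
move=> xy; have : qvert y \in [set B | adj (qvert x) B].
  by rewrite (proj2 (cover_nbrs x)) imset_f ?inE.
by rewrite inE.
Qed.

(** If g fixes a and b is a neighbour of a, then g b and b are neighbours of a in one orbit, hence
    equal. Fixed vertices thus spread through the connected graph. *)
Lemma cover_fix g x : g \in graph_aut Gm -> g x = x ->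
  (forall y, qvert (g y) = qvert y) -> g = 1.
Proof.
move=> /sub_graph_autP gP gx gq; apply/permP=> y; rewrite perm1.
apply: (connect_ind (P := fun y => g y = y)) (Gm_conn x y) => // a b ga ab.
by apply: (@cover_inj a); rewrite // -{1}ga gP.
Qed.

(** Once N has moved a to c, the image of b and the vertex d are neighbours of c in the same
    orbit. *)
Lemma cover_edge_fibre a b c d : adj a b -> adj c d ->
  qvert c = qvert a -> qvert d = qvert b ->
  exists2 n, n \in N & n a = c /\ n b = d.
Proof.
move=> ab cd /eqP/qvertP[n nN na] db; exists n => //; split=> //.
apply: (@cover_inj c); rewrite // ?db ?qvert_act // -na.
by have /sub_graph_autP -> := subsetP N_aut n nN.
Qed.

End Cover.
End Quotient.

(** * Groups regular on edges and preserving the sides *)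

Lemma inj_surj_bij (A B : finType) (f : A -> B) :
  injective f -> (forall y, exists x, f x == y) -> bijective f.
Proof.
move=> fI fS; have fK : cancel (fun y => xchoose (fS y)) f.
  by move=> y; apply/eqP; exact: (xchooseP (fS y)).
by exists (fun y => xchoose (fS y)) => // x; apply: fI.
Qed.

Lemma adj_neq (Gm : sgraph) (x y : Gm) : adj x y -> x != y.
Proof. by apply: contraL => /eqP->; rewrite adj_irrefl. Qed.

Section EdgeTransitive.
Variables (aT : finGroupType) (D : {group aT}) (Gm : sgraph).
Variables (to : action D Gm) (L : {group aT}).

Lemma setact_set2 a b l : (to^*)%act [set a; b] l = [set to a l; to b l].
Proof. exact: imset_set2. Qed.

Lemma edge_transitive_elim a b c d : edge_transitive to L ->
  adj a b -> adj c d -> exists2 l, l \in L & [set to a l; to b l] = [set c; d].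
Proof.
move=> [[LD _] Ltr] ab cd.
have abE : [set a; b] \in edges Gm by rewrite edges_pair.
have cdE : [set c; d] \in edges Gm by rewrite edges_pair.
have [l lL ->] := atransP2in LD Ltr abE cdE.
by exists l; rewrite // setact_set2.
Qed.

Lemma edge_transitive_intro a b : acts_as_auts to L -> adj a b ->
  (forall c d, adj c d ->
     exists2 l, l \in L & [set to a l; to b l] = [set c; d]) ->
  edge_transitive to L.
Proof.
move=> Laut ab Ltr; split=> //; apply/imsetP; exists [set a; b].
  by rewrite edges_pair.
apply/setP=> E; apply/edgesP/orbitP=> [[c [d [cd ->]]]|[l lL <-]].
  by have [l lL <-] := Ltr c d cd; exists l; rewrite // setact_set2.
exists (to a l), (to b l); rewrite setact_set2; split=> //.
by have [_ ->] := Laut.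
Qed.

End EdgeTransitive.

(* By frame_trans the orbits of u and v cover all vertices of positive        *)
(* valency; frame_sides keeps them apart.                                     *)
Record edge_frame (Gm : sgraph) (H : {group {perm Gm}}) (u v : Gm) : Prop :=
  EdgeFrame {
    frame_adj : adj u v;
    frame_aut : H \subset graph_aut Gm;
    frame_trans : forall a b, adj a b ->
      exists2 h, h \in H & [set h u; h v] = [set a; b];
    frame_free : forall h, h \in H -> [set h u; h v] = [set u; v] -> h = 1;
    frame_sides : forall h, h \in H -> h u != v }.

Section Frame.
Variables (Gm : sgraph) (H : {group {perm Gm}}).

Lemma frame_sym u v : edge_frame H u v -> edge_frame H v u.
Proof.
move=> [uv aut tr fr sd]; split=> // [|a b ab|h hH|h hH]; first by rewrite adj_sym.
- by have [h hH <-] := tr a b ab; exists h; rewrite // setUC.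
- by rewrite setUC (setUC [set v]); apply: fr.
by apply: contra (sd h^-1 (groupVr hH)) => /eqP <-; rewrite permK.
Qed.

Lemma mem_stab u h : (h \in 'C_H[u | 'P]) = (h \in H) && (h u == u).
Proof. by rewrite inE; congr (_ && _); apply/astab1P/eqP. Qed.

Variables u v : Gm.
Hypothesis F : edge_frame H u v.

Lemma frame_adjE h a b : h \in H -> adj (h a) (h b) = adj a b.
Proof. by move=> /(subsetP (frame_aut F))/sub_graph_autP. Qed.

(** An element carrying {u,v} onto {u,a} cannot send v to u, so it fixes u. *)
Lemma frame_nbr a : adj u a -> exists2 x, x \in 'C_H[u | 'P] & x v = a.
Proof.
move=> /(frame_trans F)[h hH] /set2_inj[[hu hv]|[hu hv]].
  by exists h; rewrite // mem_stab hH hu eqxx.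
by have := frame_sides F (groupVr hH); rewrite -hv permK eqxx.
Qed.

Lemma frame_fix_inj x y : x \in 'C_H[u | 'P] -> y \in 'C_H[u | 'P] ->
  x v = y v -> x = y.
Proof.
rewrite !mem_stab => /andP[xH /eqP xu] /andP[yH /eqP yu] xy.
apply/eqP; rewrite eq_mulgV1; apply/eqP/(frame_free F); first by rewrite groupM ?groupV.
by rewrite !permM xu xy permK -{1}yu permK.
Qed.

Lemma frame_nbrs : [set a | adj u a] = [set x v | x : {perm Gm} in 'C_H[u | 'P]].
Proof.
apply/setP=> a; rewrite inE; apply/idP/imsetP=> [/frame_nbr[x xX <-]|[x + ->]].
  by exists x.
rewrite mem_stab => /andP[xH /eqP xu].
by rewrite -{1}xu frame_adjE // (frame_adj F).
Qed.

Lemma frame_card_stab : #|'C_H[u | 'P]| = #|[set a | adj u a]|.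
Proof.
by rewrite frame_nbrs card_in_imset // => x y; apply: frame_fix_inj.
Qed.

End Frame.

Section FrameGen.
Variables (Gm : sgraph) (H : {group {perm Gm}}) (u v : Gm).
Hypotheses (F : edge_frame H u v) (Gm_conn : connected_graph Gm).

Lemma frame_gen_vertex w : exists2 k, k \in <<'C_H[u | 'P] :|: 'C_H[v | 'P]>> &
  w = k u \/ w = k v.
Proof.
have KH : <<'C_H[u | 'P] :|: 'C_H[v | 'P]>> \subset H.
  by rewrite gen_subG subUset !subsetIl.
pose P w := exists2 k, k \in <<'C_H[u | 'P] :|: 'C_H[v | 'P]>> & w = k u \/ w = k v.
apply: (connect_ind (P := P)) (Gm_conn u w) => [|a b [k kK ak] ab].
  by exists 1; rewrite ?group1 // perm1; left.
have kH := subsetP KH k kK.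
(* Translating back by k reduces the next edge of the walk to one at u or v, where [frame_nbr]
   applies. *)
have : adj (k^-1 a) (k^-1 b) by rewrite (frame_adjE F) ?groupV.
case: ak => ->; rewrite permK.
  move=> /(frame_nbr F)[x xX xv]; exists (x * k); last by right; rewrite permM xv permKV.
  by rewrite groupM // mem_gen // inE xX.
move=> /(frame_nbr (frame_sym F))[y yY yu]; exists (y * k).
  by rewrite groupM // mem_gen // inE yY orbT.
by left; rewrite permM yu permKV.
Qed.

(** Some k in the generated subgroup sends u or v to h u. The second case would mix the sides; in
    the first, h k^-1 fixes u. *)
Lemma frame_gen : H :=: <<'C_H[u | 'P] :|: 'C_H[v | 'P]>>.
Proof.
apply/eqP; rewrite eqEsubset andbC gen_subG subUset !subsetIl /=.
apply/subsetP=> h hH; have [k kK hk] := frame_gen_vertex (h u).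
have kH : k \in H.
  by apply: (subsetP _ k kK); rewrite gen_subG subUset !subsetIl.
rewrite -(mulgKV k h) groupM // mem_gen // inE mem_stab groupM ?groupV //=.
rewrite permM; case: hk => hk; first by rewrite hk permK eqxx.
by have := frame_sides F (groupM hH (groupVr kH)); rewrite permM hk permK eqxx.
Qed.

Lemma frame_vertex w : exists2 h, h \in H & w = h u \/ w = h v.
Proof. by have := frame_gen_vertex w; rewrite -frame_gen. Qed.

Lemma frame_meet g h : g \in H -> h \in H ->
  ([set g u; g v] :&: [set h u; h v] != set0) =
  (h * g^-1 \in 'C_H[u | 'P] :|: 'C_H[v | 'P]).
Proof.
move=> gH hH; rewrite in_setU !mem_stab groupM ?groupV //= !permM.
have E a b : (g^-1 (h a) == b) = (h a == g b).
  by rewrite -(inj_eq (@perm_inj _ g)) permKV.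
rewrite !E; apply/set0Pn/orP=> [[w]|[]/eqP ha]; last first.
- by exists (h v); rewrite !inE ha !eqxx !orbT.
- by exists (h u); rewrite !inE ha !eqxx.
rewrite !inE => /andP[/orP[]/eqP-> /orP[]/eqP gh].
- by left; rewrite gh.
- by have := frame_sides F (groupM gH (groupVr hH)); rewrite permM gh permK eqxx.
- by have := frame_sides F (groupM hH (groupVr gH)); rewrite permM -gh permK eqxx.
by right; rewrite gh.
Qed.

End FrameGen.

(** * The line graph and the natural action on it *)

Section LineGraphAction.
Variable Gm : sgraph.

Fact ledge_subproof (p : Gm * Gm) : adj p.1 p.2 -> [set p.1; p.2] \in edges Gm.
Proof. by rewrite edges_pair. Qed.

Definition ledge (a b : Gm) (ab : adj a b) : line_graph Gm :=
  exist (fun E => E \in edges Gm) _ (ledge_subproof (p := (a, b)) ab).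

Lemma line_adj_intro a b c (ab : adj a b) (bc : adj b c) : a != c ->
  adj (ledge ab) (ledge bc).
Proof.
move=> ac; rewrite /= /line_adj; apply/andP; split.
  rewrite -val_eqE /=; apply: contra ac => /eqP/set2_inj[[-> ->] //|[-> _] //].
by apply/set0Pn; exists b; rewrite !inE !eqxx orbT.
Qed.

(** Together with [line_adj_intro], this identifies edges of the line graph with 2-arcs up to
    reversal. *)
Lemma line_adj_elim (E1 E2 : line_graph Gm) : adj E1 E2 ->
  exists a b c, [/\ is_2arc a b c, val E1 = [set a; b] & val E2 = [set b; c]].
Proof.
case: E1 E2 => [E1 E1e] [E2 E2e] /andP[neq /set0Pn[b]] /=.
have neqE : E1 != E2 by [].
have endpoint E : E \in edges Gm -> b \in E -> exists2 a, adj a b & E = [set a; b].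
  case/edgesP=> x [y [xy ->]]; rewrite !inE => /orP[]/eqP->.
    by exists y; rewrite 1?adj_sym // setUC.
  by exists x.
rewrite inE => /andP[/(endpoint _ E1e)[a ab E1E] /(endpoint _ E2e)[c cb E2E]].
exists a, b, c; split=> //; last by rewrite setUC.
rewrite /is_2arc ab (adj_sym b) cb !andbT.
by apply: contra neqE => /eqP ac; rewrite E1E E2E ac.
Qed.

Lemma line_action_dom g : g \in graph_aut Gm ->
  g \in subact_dom (fun E => E \in edges Gm) ('P^*)%act.
Proof.
move=> /sub_graph_autP gP; rewrite !inE /=; apply/subsetP=> E.
rewrite !inE => /edgesP[x [y [xy ->]]].
by rewrite /= setact_set2 edges_pair /= gP.
Qed.

Lemma line_actionE g E : g \in graph_aut Gm ->
  val (line_action Gm E g) = g @: val E.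
Proof. by move=> gP; rewrite val_subact line_action_dom. Qed.

Lemma line_acts_as_auts (G : {group {perm Gm}}) : G \subset graph_aut Gm ->
  acts_as_auts (line_action Gm) G.
Proof.
move=> /subsetP Gaut; split=> [|g /Gaut gA E1 E2].
  by apply/subsetP=> g /Gaut/line_action_dom.
rewrite /= /line_adj (inj_eq (@act_inj _ _ _ _ g)).
rewrite !(line_actionE _ gA) -imsetI; last by move=> ? ? _ _; apply: perm_inj.
by rewrite imset_eq0.
Qed.

End LineGraphAction.

(** * Mixed dihedral groups *)

(** An elementary abelian 2-group is determined by its order. *)
Lemma isog_C2pow (gT : finGroupType) (A : {group gT}) m :
  A \isog C2pow m = 2.-abelem A && (#|A| == 2 ^ m)%N.
Proof.
have CA : 2.-abelem (C2pow m) by apply: mx_Fp_abelem.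
have cC : #|C2pow m| = (2 ^ m)%N by rewrite cardsT card_mx card_Fp // mul1n.
by rewrite isog_sym (isog_abelem_card _ CA) cC.
Qed.

Lemma isog_C2pow_setX (gT : finGroupType) (A : {group gT}) m :
  A \isog setX (C2pow m) (C2pow m) = 2.-abelem A && (#|A| == 2 ^ (2 * m))%N.
Proof.
have CA : 2.-abelem (C2pow m) by apply: mx_Fp_abelem.
have cC : #|C2pow m| = (2 ^ m)%N by rewrite cardsT card_mx card_Fp // mul1n.
have XA : 2.-abelem (setX (C2pow m) (C2pow m)).
  rewrite (dprod_abelem 2 (setX_dprod (C2pow m) (C2pow m))).
  by rewrite -(isog_abelem (isog_setX1 _ _)) -(isog_abelem (isog_set1X _ _)) CA.
rewrite isog_sym (isog_abelem_card _ XA) cardsX cC.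
by rewrite mul2n -addnn expnD.
Qed.

Section Join.
Variables (gT : finGroupType) (H N X Y : {group gT}).
Hypotheses (XH : X \subset H) (YH : Y \subset H) (defH : H :=: <<X :|: Y>>).
Hypotheses (nNH : N <| H) (abHN : abelian (H / N)).

Lemma quotient_join_abelian : H / N = (X / N) * (Y / N).
Proof.
have nN := normal_norm nNH.
rewrite {1}defH quotient_gen; last first.
  by rewrite subUset !(subset_trans _ nN).
rewrite quotientU -joingE cent_joinEr //.
by apply: (centSS _ _ abHN); rewrite quotientS.
Qed.

Lemma join_decomp h : h \in H ->
  exists x y n, [/\ x \in X, y \in Y, n \in N & h = x * y * n].
Proof.
move=> hH; have nN := subsetP (normal_norm nNH).
have : coset N h \in H / N by apply: mem_quotient.
rewrite quotient_join_abelian => /mulsgP[_ _ /morphimP[x xN xX ->] /morphimP[y yN yY ->]].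
rewrite -morphM // => hxy; exists x, y, ((x * y)^-1 * h); rewrite mulKVg; split=> //.
have xyN : x * y \in 'N(N) by apply: groupM.
have xyVN : (x * y)^-1 \in 'N(N) by rewrite groupV.
apply: coset_idr; first by apply: groupM => //; apply: nN.
by rewrite morphM ?(nN h) // morphV // [X in _ * X]hxy mulVg.
Qed.

(** Product formula for H / N = (X / N)(Y / N), combined with Lagrange for X and Y over their
    intersections with N. *)
Lemma card_join_quotient :
  (#|H / N| * (#|X :&: N| * #|Y :&: N| * #|(X / N) :&: (Y / N)|))%N = (#|X| * #|Y|)%N.
Proof.
have nN := normal_norm nNH.
have := mul_cardG (X / N) (Y / N); rewrite -quotient_join_abelian.
rewrite !card_quotient ?(subset_trans XH) ?(subset_trans YH) // => E.
rewrite -(LagrangeI X N) -(LagrangeI Y N) mulnACA E.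
by rewrite mulnCA mulnA.
Qed.

Hypothesis cardHN : #|H / N| = (#|X| * #|Y|)%N.

(** Equality of orders leaves no room for a nontrivial factor in [card_join_quotient]; H / N is then
    the direct product of faithful images of X and Y. *)
Lemma join_TI : [/\ X :&: N = 1, Y :&: N = 1 & (X / N) :&: (Y / N) = 1].
Proof.
have /eqP := card_join_quotient; rewrite -cardHN -{2}[#|H / N|]muln1.
rewrite eqn_pmul2l ?cardG_gt0 // !muln_eq1 -!trivg_card1.
by case/andP=> /andP[/eqP ? /eqP ?] /eqP ?; split.
Qed.

Lemma join_disj x y n : x \in X -> y \in Y -> n \in N -> x = y * n ->
  x = 1 /\ y = 1.
Proof.
have [tX tY tXY] := join_TI; move=> xX yY nN xyn.
have nNN := subsetP (normal_norm nNH).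
have yN : y \in 'N(N) by apply/nNN/(subsetP YH).
have xNE : coset N x = coset N y by rewrite xyn coset_kerr.
have : coset N x \in (X / N) :&: (Y / N).
  by rewrite inE {2}xNE !mem_quotient.
rewrite tXY => /set1P x1.
have xN : x \in N by apply: coset_idr => //; apply/nNN/(subsetP XH).
have y1 : y \in N by apply: coset_idr => //; rewrite -xNE.
have : x \in X :&: N by apply/setIP.
have : y \in Y :&: N by apply/setIP.
by rewrite tX tY => /set1P-> /set1P->.
Qed.

End Join.

Section MixedDihedralCriterion.
Variables (gT : finGroupType) (H X Y : {group gT}) (n : nat).

(** H' lies in N because H / N is abelian. Conversely H / H' is generated by images of X and Y, so
    its order is at most |X||Y| = |H / N|, which forces H' = N. *)
Lemma mixed_dihedral_of_quotient (N : {group gT}) :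
  X \subset H -> Y \subset H -> H :=: <<X :|: Y>> -> N <| H ->
  2.-abelem (H / N) -> #|H / N| = (2 ^ (2 * n))%N ->
  X :&: N = 1 -> Y :&: N = 1 -> #|X| = (2 ^ n)%N -> #|Y| = (2 ^ n)%N ->
  mixed_dihedral H X Y n /\ H^`(1) = N.
Proof.
move=> XH YH defH nNH abN cN tX tY cX cY.
have nN := normal_norm nNH.
have ab (Z : {group gT}) : Z \subset H -> Z :&: N = 1 -> 2.-abelem Z.
  move=> ZH tZ; have nZ := subset_trans ZH nN.
  by rewrite (isog_abelem (quotient_isog nZ _)) 1?setIC // (abelemS _ abN) ?quotientS.
have H'N : H^`(1) = N.
  apply/eqP; rewrite eqEcard der1_min ?(abelem_abelian abN) //=.
  have le : (#|H / H^`(1)| <= #|H / N|)%N.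
    rewrite cN mul2n -addnn expnD -{1}cX -cY.
    rewrite -(card_join_quotient XH YH defH (der_normal 1 H) (der_abelian 0 H)).
    by rewrite leq_pmulr // !muln_gt0 !cardG_gt0.
  rewrite -(leq_pmul2r (cardG_gt0 (H / N)%G)) [#|H / N|](card_quotient nN).
  rewrite Lagrange ?normal_sub // -(Lagrange (der_sub 1 H)) leq_pmul2l //.
  by rewrite -!card_quotient ?der_norm.
split=> //; split=> //; first by rewrite !isog_C2pow cX cY !eqxx !ab.
by rewrite H'N isog_C2pow abN cN eqxx.
Qed.

Lemma mixed_dihedral_card : mixed_dihedral H X Y n ->
  [/\ #|X| = 2 ^ n, #|Y| = 2 ^ n & #|H / H^`(1)| = #|X| * #|Y|]%N.
Proof.
case=> _ [+ +] _; rewrite !isog_C2pow.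
move=> /andP[_ /eqP->] /andP[_ /eqP->] /andP[_ /eqP->].
by rewrite mul2n -addnn expnD.
Qed.

End MixedDihedralCriterion.

(** * From normal covers to mixed dihedral groups *)

Lemma complete_bipartite_valency k : has_valency k (complete_bipartite k k).
Proof.
have inlI : injective (@inl 'I_k 'I_k) by move=> ? ? [].
have inrI : injective (@inr 'I_k 'I_k) by move=> ? ? [].
case=> i; rewrite -[RHS](card_ord k) -cardsT.
  rewrite -(card_imset _ inrI); apply: eq_card => -[] j; rewrite !inE /=.
    by apply/esym/negbTE/negP => /imsetP[].
  by rewrite imset_f.
rewrite -(card_imset _ inlI); apply: eq_card => -[] j; rewrite !inE /=.
  by rewrite imset_f.
by apply/esym/negbTE/negP => /imsetP[].
Qed.

Lemma iso_valency k (K L : sgraph) :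
  graph_isomorphic K L -> has_valency k L -> has_valency k K.
Proof.
case=> f [fb fadj] kL x; rewrite -(kL (f x)) -(card_imset _ (bij_inj fb)).
apply: eq_card => y; rewrite inE; have [g fK gK] := fb.
apply/imsetP/idP => [[z + ->]|]; first by rewrite inE fadj.
by rewrite -(gK y) fadj => xy; exists (g y); rewrite ?inE.
Qed.

Lemma has_valency_inj k l (K : sgraph) (x : K) :
  has_valency k K -> has_valency l K -> k = l.
Proof. by move=> kK lK; rewrite -(kK x). Qed.

Lemma valency_nbr k (K : sgraph) (x : K) :
  has_valency k K -> (0 < k)%N -> exists y, adj x y.
Proof. by move=> kK; rewrite -(kK x) => /card_gt0P[y]; rewrite inE; exists y. Qed.

Section CoverToFrame.
Variables (Gm : sgraph) (H N : {group {perm Gm}}) (k : nat).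
Hypotheses (Gm_conn : connected_graph Gm) (H_aut : H \subset graph_aut Gm).
Hypotheses (nNH : N <| H) (k_gt0 : (0 < k)%N).
Hypotheses (Gm_val : has_valency k Gm) (q_val : has_valency k (normal_quotient N)).
Hypothesis H_intrans :
  ~~ [transitive H / N, on [set: normal_quotient N] | normal_quotient_action N].
Hypothesis H_reg : edge_regular (normal_quotient_action N) (H / N).

Let N_aut : N \subset graph_aut Gm.
Proof. exact: subset_trans (normal_sub nNH) H_aut. Qed.

Let nN h : h \in H -> h \in 'N(N).
Proof. exact/subsetP/normal_norm. Qed.

Lemma quotient_edge_elim a b c d : adj a b -> adj c d ->
  exists2 h, h \in H & [set qvert N (h a); qvert N (h b)] = [set qvert N c; qvert N d].
Proof.
move=> ab cd; have [Htr _] := H_reg.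
have cov := cover_adj N_aut Gm_val q_val.
have [_ /morphimP[h hN hH ->] E] := edge_transitive_elim (L := (H / N)%G) Htr (cov _ _ ab) (cov _ _ cd).
by exists h => //; rewrite -E !quotient_actionE.
Qed.

(** H / N moves the orbit pair of {u,v} onto that of any edge, and N then corrects within the fibre.
    An h fixing {u,v} lies in N by regularity below; it cannot swap u and v, which lie in different
    orbits, so it fixes u and is trivial by [cover_fix]. *)
Lemma cover_frame u v : adj u v -> edge_frame H u v.
Proof.
move=> uv; have [[[HD _] _] Hreg] := H_reg.
have cov := cover_adj N_aut Gm_val q_val.
have fib := cover_edge_fibre N_aut Gm_val q_val.
have trE a b : adj a b -> exists2 h, h \in H & [set h u; h v] = [set a; b].
  move=> ab; have [h hH E] := quotient_edge_elim uv ab.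
  have huv : adj (h u) (h v) by have /sub_graph_autP -> := subsetP H_aut h hH.
  have {E} [[Eu Ev]|[Eu Ev]] := set2_inj E.
    have [n nN' [nu nv]] := fib _ _ _ _ huv ab (esym Eu) (esym Ev).
    by exists (h * n); rewrite ?groupM ?(subsetP (normal_sub nNH) n) // !permM nu nv.
  rewrite adj_sym in ab.
  have [n nN' [nu nv]] := fib _ _ _ _ huv ab (esym Eu) (esym Ev).
  by exists (h * n); rewrite ?groupM ?(subsetP (normal_sub nNH) n) // !permM nu nv setUC.
split=> // h hH.
  move=> E; have hN : h \in N.
    apply: coset_idr; first exact: nN.
    have : coset N h \in 'C_(H / N)[[set qvert N u; qvert N v] | (normal_quotient_action N)^*].
      rewrite inE mem_quotient //= inE (subsetP HD) ?mem_quotient //=.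
      rewrite inE sub1set inE setactE imset_set2 !quotient_actionE ?nN //.
      by case: (set2_inj E) => [] [-> ->]; rewrite // setUC.
    by rewrite Hreg ?edges_pair ?cov // => /set1P.
  have [[hu _]|[hu _]] := set2_inj E; last first.
    by have := adj_neq (cov _ _ uv); rewrite -hu qvert_act ?eqxx.
  apply: (cover_fix N_aut Gm_conn Gm_val q_val _ hu) => [|y].
    exact: subsetP H_aut h hH.
  by rewrite qvert_act.
(* If h u = v, then every orbit, containing an end of some edge, is an image of the orbit of u, so H
   / N would be vertex-transitive. *)
apply: contra H_intrans => /eqP huv; apply/imsetP; exists (qvert N u) => //.
apply/esym/setP=> B; rewrite inE; have [w ->] := qvert_surj B.
have [z wz] := valency_nbr w Gm_val k_gt0.
have [h' h'H E] := quotient_edge_elim uv wz.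
have : qvert N w \in [set qvert N (h' u); qvert N (h' v)] by rewrite E set21.
case/set2P=> ->; apply/orbitP.
  by exists (coset N h'); rewrite ?mem_quotient // quotient_actionE ?nN.
exists (coset N (h * h')); rewrite ?mem_quotient ?groupM //.
by rewrite quotient_actionE ?nN ?groupM // permM huv.
Qed.

Lemma cover_stab_TI w : 'C_H[w | 'P] :&: N = 1.
Proof.
apply/trivgP/subsetP=> h /setIP[]; rewrite mem_stab => /andP[hH /eqP hw] hN.
apply/set1P; apply: (cover_fix N_aut Gm_conn Gm_val q_val _ hw) => [|y].
  exact: subsetP H_aut h hH.
by rewrite qvert_act.
Qed.

End CoverToFrame.

Section FrameLine.
Variables (Gm : sgraph) (H : {group {perm Gm}}) (u v : Gm).
Hypotheses (F : edge_frame H u v) (Gm_conn : connected_graph Gm).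

Lemma frame_line_graph :
  line_graph_is_mixed_dihedral H 'C_H[u | 'P] 'C_H[v | 'P].
Proof.
have adjh (g : subg_of H) : adj (sgval g u) (sgval g v).
  by rewrite (frame_adjE F) ?subgP // (frame_adj F).
pose phi (g : mixed_dihedral_graph H 'C_H[u | 'P] 'C_H[v | 'P]) := ledge (adjh g).
have phi_inj : injective phi.
  move=> g h /(congr1 val)/= E; apply: val_inj => /=.
  apply/eqP; rewrite eq_mulgV1; apply/eqP/(frame_free F).
    by rewrite groupM ?groupV ?subgP.
  by rewrite !permM; case: (set2_inj E) => [] [-> ->]; rewrite !permK // setUC.
exists phi; split; [split|].
- apply: inj_surj_bij => // -[E Ee].
  have /edgesP[a [b [ab EE]]] := Ee.
  have [h hH hE] := frame_trans F ab.
  by exists (subg H h); rewrite -val_eqE /= subgK // hE EE.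
- move=> g h; rewrite /= /line_adj (inj_eq phi_inj) /=.
  rewrite (frame_meet F) ?subgP // /cay_adj.
  apply/andP/exists_inP=> [[neq mem]|[s]].
    exists (sgval h * (sgval g)^-1); rewrite ?mulgKV // inE mem andbT.
    by rewrite inE -eq_mulgV1 eq_sym.
  rewrite inE => /andP[]; rewrite inE => s1 sS /eqP hE.
  rewrite hE mulgK; split=> //; apply: contra s1 => /eqP gh.
  by rewrite -(mulgK (sgval g) s) -hE gh mulgV.
move=> g h; apply: val_inj; rewrite line_actionE.
  by rewrite /= imset_set2 !permM.
by rewrite (subsetP (frame_aut F)) ?subgP.
Qed.

End FrameLine.

Lemma two_arc_line_transitive (Gm : sgraph) (G : {group {perm Gm}}) (a b c : Gm) :
  two_arc_transitive G -> is_2arc a b c ->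
  edge_transitive (line_action Gm) G.
Proof.
move=> [Gaut Gtr] abc; have /and3P[ac ab bc] := abc.
apply: (edge_transitive_intro _ (line_adj_intro ab bc ac)).
  exact: line_acts_as_auts.
move=> E1 E2 /line_adj_elim[a' [b' [c' [abc' E1E E2E]]]].
have [g gG [ga gb gc]] := Gtr _ _ _ _ _ _ abc abc'.
have gA := subsetP Gaut g gG; exists g => //.
congr ([set _ ; _]); apply: val_inj; rewrite line_actionE //= imset_set2.
  by rewrite ga gb.
by rewrite gb gc.
Qed.

(** * From mixed dihedral groups to normal covers *)

Section CliqueFrame.
Variables (Gm : sgraph) (H : {group {perm Gm}}) (u v : Gm).
Hypotheses (uv : adj u v) (H_aut : H \subset graph_aut Gm).

Let E (h : {perm Gm}) := [set h u; h v].

Hypothesis E_onto : forall a b, adj a b -> exists2 h, h \in H & E h = [set a; b].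
Hypothesis E_inj : forall g h, g \in H -> h \in H -> E g = E h -> g = h.

(** If h u = v, then an edge E x through u is moved to an edge through v, so X h lies in Y; since 1
    is in X, h itself is in Y, and X would lie in Y. *)
Lemma frame_of_stars (X Y : {group {perm Gm}}) :
  ~~ (X \subset Y) ->
  (forall h, h \in H -> (u \in E h) = (h \in X)) ->
  (forall h, h \in H -> (v \in E h) = (h \in Y)) ->
  X \subset H -> Y \subset H ->
  [/\ edge_frame H u v, 'C_H[u | 'P] = X & 'C_H[v | 'P] = Y].
Proof.
move=> nXY uX vY /subsetP XH /subsetP YH.
have sides h : h \in H -> h u != v.
  move=> hH; apply: contra nXY => /eqP hu.
  have Xh x : x \in X -> x * h \in Y.
    move=> xX; have xH := XH x xX; rewrite -vY ?groupM // -hu.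
    by move: xX; rewrite -uX // !inE !permM !(inj_eq perm_inj).
  apply/subsetP=> x /Xh xh; have := Xh 1 (group1 X); rewrite mul1g => hY.
  by rewrite -(groupMr _ hY).
split.
- split=> // h hH; rewrite -/(E h) => hE; apply: E_inj; rewrite ?group1 // hE.
  by rewrite /E !perm1.
- apply/setP=> h; rewrite mem_stab; apply/andP/idP=> [[hH /eqP hu]|hX].
    by rewrite -uX // /E hu set21.
  have hH := XH h hX; split=> //; move: hX; rewrite -uX // => /set2P[<- //|hv].
  by have := sides _ (groupVr hH); rewrite hv permK eqxx.
apply/setP=> h; rewrite mem_stab; apply/andP/idP=> [[hH /eqP hv]|hY].
  by rewrite -vY // /E hv set22.
have hH := YH h hY; split=> //; move: hY; rewrite -vY // => /set2P[hv|<- //].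
by have := sides _ hH; rewrite -hv eqxx.
Qed.

Variables X Y : {group {perm Gm}}.
Hypotheses (XH : X \subset H) (YH : Y \subset H) (tXY : X :&: Y = 1).
Hypotheses (X1 : X :!=: 1) (Y1 : Y :!=: 1).
Hypothesis E_meet : forall g h, g \in H -> h \in H ->
  (E g :&: E h != set0) = (h * g^-1 \in X :|: Y).

Let in_both z : z \in X -> z \in Y -> z = 1.
Proof. by move=> zX zY; apply/set1P; rewrite -[[set _]]tXY inE zX. Qed.

(* All pairs of edges through w meet, whereas x * y^-1 lies outside X and Y   *)
(* for nontrivial x in X and y in Y.                                          *)
Lemma star_clique w (Z := [set h in H | w \in E h]) :
  1 \in Z -> Z \subset X \/ Z \subset Y.
Proof.
move=> Z1; have memZ h : h \in Z = (h \in H) && (w \in E h) by rewrite in_set.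
have meet g h : g \in Z -> h \in Z -> (h * g^-1 \in X) || (h * g^-1 \in Y).
  rewrite !memZ => /andP[gH wg] /andP[hH wh].
  have := E_meet gH hH; rewrite in_setU => <-.
  by apply/set0Pn; exists w; apply/setIP.
have ZXY h : h \in Z -> (h \in X) || (h \in Y).
  by move=> hZ; have := meet 1 h Z1 hZ; rewrite invg1 mulg1.
have [ZX|/subsetPn[g gZ gX]] := boolP (Z \subset X); [by left|right].
have gY : g \in Y by have := ZXY g gZ; rewrite (negbTE gX).
apply/subsetP=> h hZ; have /orP[hX|//] := ZXY h hZ.
have /orP[|] := meet g h gZ hZ; last by rewrite groupMr ?groupV.
by rewrite groupMl // groupV (negbTE gX).
Qed.

(** Each of the stars of u and v lies in X or in Y. They cover the union of X and Y, so they do not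
    both lie in the same one; which is which remains undetermined. *)
Lemma clique_frame :
  [/\ edge_frame H u v, 'C_H[u | 'P] = X & 'C_H[v | 'P] = Y] \/
  [/\ edge_frame H u v, 'C_H[u | 'P] = Y & 'C_H[v | 'P] = X].
Proof.
have E1 : E 1 = [set u; v] by rewrite /E !perm1.
have only1 h : h \in H -> u \in E h -> v \in E h -> h = 1.
  move=> hH uh vh; apply: E_inj; rewrite ?group1 // E1.
  have := adj_neq uv; move: uh vh; rewrite /E.
  case/set2P=> hu /set2P[hv|hv]; first by rewrite hv -hu eqxx.
  - by rewrite -hu -hv.
  - by rewrite -hu -hv setUC.
  by rewrite hu -hv eqxx.
have cover h : h \in X :|: Y -> (u \in E h) || (v \in E h).
  move=> hXY; have hH : h \in H.
    by move: h hXY; apply/subsetP; rewrite subUset XH.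
  have := E_meet (group1 H) hH; rewrite invg1 mulg1 hXY E1 => /set0Pn[w].
  by rewrite inE => /andP[/set2P[->|->] ->]; rewrite ?orbT.
pose A := [set h in H | u \in E h]; pose B := [set h in H | v \in E h].
have A1 : 1 \in A by rewrite in_set group1 E1 set21.
have B1 : 1 \in B by rewrite in_set group1 E1 set22.
have ntriv (Z T : {group {perm Gm}}) : Z :!=: 1 -> Z :&: T = 1 -> ~~ (Z \subset T).
  by move=> Z1 ZT; apply: contra Z1 => /setIidPl <-; rewrite ZT.
have nXY := ntriv X Y X1 tXY; have nYX := ntriv Y X Y1 (etrans (setIC _ _) tXY).
(* Inclusions of stars become equalities: an element of Z missing from the star of w is in the star
   of w', hence in T, hence is 1, whose edge does contain w. *)
have side (Z T : {group {perm Gm}}) w w' : Z \subset H -> Z \subset X :|: Y ->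
    (forall z, z \in Z -> z \in T -> z = 1) ->
    (forall h, h \in X :|: Y -> (w \in E h) || (w' \in E h)) -> w \in E 1 ->
    [set h in H | w \in E h] \subset Z -> [set h in H | w' \in E h] \subset T ->
    forall h, h \in H -> (w \in E h) = (h \in Z).
  move=> ZH ZXY ZT cov w1 /subsetP wZ /subsetP wT h hH.
  apply/idP/idP=> [wh|hZ]; first by apply: wZ; rewrite in_set hH.
  have /orP[//|w'h] := cov h (subsetP ZXY h hZ).
  by rewrite (ZT h) // wT // in_set hH.
have nsub (Z : {group {perm Gm}}) : A \subset Z -> B \subset Z -> X :|: Y \subset Z.
  move=> /subsetP AZ /subsetP BZ; apply/subsetP=> h hXY.
  have hH : h \in H by apply: (subsetP _ h hXY); rewrite subUset XH.
  by have /orP[wh|wh] := cover h hXY; [apply: AZ | apply: BZ]; rewrite in_set hH.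
have cover' h : h \in X :|: Y -> (v \in E h) || (u \in E h) by rewrite orbC; exact: cover.
have in_both' z : z \in Y -> z \in X -> z = 1 by move=> *; apply: in_both.
have [AX|AY] := star_clique A1; have [BX|BY] := star_clique B1.
- by have := nsub X AX BX; rewrite subUset (negbTE nYX) andbF.
- left; apply: frame_of_stars => //.
    by apply: (side _ Y _ v); rewrite ?subsetUl // E1 set21.
  by apply: (side _ X _ u); rewrite ?subsetUr // E1 set22.
- right; apply: frame_of_stars => //.
    by apply: (side _ X _ v); rewrite ?subsetUr // E1 set21.
  by apply: (side _ Y _ u); rewrite ?subsetUl // E1 set22.
by have := nsub Y AY BY; rewrite subUset (negbTE nXY).
Qed.

End CliqueFrame.

(** Take {u,v} to be the edge labelled 1; equivariance makes h the label of {h u, h v}. *)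
Lemma line_graph_frame (Gm : sgraph) (H X Y : {group {perm Gm}}) :
  H \subset graph_aut Gm -> X \subset H -> Y \subset H ->
  X :&: Y = 1 -> X :!=: 1 -> Y :!=: 1 ->
  line_graph_is_mixed_dihedral H X Y ->
  exists u v, [/\ edge_frame H u v, 'C_H[u | 'P] = X & 'C_H[v | 'P] = Y].
Proof.
move=> H_aut XH YH tXY X1 Y1 [phi [[phi_bij phi_adj] phi_act]].
have phi_inj := bij_inj phi_bij.
have /edgesP[u [v [uv phi1]]] := valP (phi (subg H 1)).
have phiE h : h \in H -> val (phi (subg H h)) = [set h u; h v].
  move=> hH; have -> : subg H h = subg H 1 * subg H h by rewrite -morphM ?group1 // mul1g.
  rewrite phi_act line_actionE subgK // ?(subsetP H_aut) //.
  by rewrite phi1 imset_set2.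
have inj g h : g \in H -> h \in H -> [set g u; g v] = [set h u; h v] -> g = h.
  move=> gH hH gh; rewrite -[g](@subgK _ H) // -[h](@subgK _ H) //; congr sgval.
  by apply/phi_inj/val_inj; rewrite !phiE.
have onto a b : adj a b -> exists2 h, h \in H & [set h u; h v] = [set a; b].
  move=> ab; have [psi psiK phiK] := phi_bij.
  exists (sgval (psi (ledge ab))); first exact: subgP.
  by rewrite -phiE ?subgP // sgvalK phiK.
have meet g h : g \in H -> h \in H ->
    ([set g u; g v] :&: [set h u; h v] != set0) = (h * g^-1 \in X :|: Y).
  move=> gH hH; have [->|gh] := eqVneq g h.
    by rewrite mulgV !inE group1 setIid; apply/set0Pn; exists (h u); rewrite set21.
  have := phi_adj (subg H g) (subg H h).
  rewrite /= /line_adj (inj_eq phi_inj) !phiE // /cay_adj !subgK //.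
  have -> /= : subg H g != subg H h.
    by apply: contra gh => /eqP/(congr1 sgval); rewrite !subgK // => ->.
  move=> ->; apply/exists_inP/idP=> [[s] |hg].
    by rewrite inE => /andP[_ sS] /eqP->; rewrite mulgK.
  exists (h * g^-1); last by rewrite mulgKV.
  by rewrite inE hg inE -eq_mulgV1 eq_sym gh.
case: (clique_frame uv H_aut onto inj XH YH tXY X1 Y1 meet) => [[F CX CY]|[F CX CY]].
  by exists u, v.
by exists v, u; split=> //; apply: frame_sym.
Qed.

Lemma mixed_dihedral_sym (gT : finGroupType) (H X Y : {group gT}) n :
  mixed_dihedral H X Y n -> mixed_dihedral H Y X n.
Proof. by case=> [[XH YH] [Xn Yn] defH Hn]; split=> //; rewrite setUC. Qed.

Lemma mixed_dihedral_join (gT : finGroupType) (H X Y : {group gT}) n :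
  mixed_dihedral H X Y n ->
  [/\ forall h, h \in H -> exists x y z,
        [/\ x \in X, y \in Y, z \in H^`(1) & h = x * y * z]
    & forall x y z, x \in X -> y \in Y -> z \in H^`(1) -> x = y * z ->
        x = 1 /\ y = 1].
Proof.
move=> XYn; have [[XH YH] _ defH _] := XYn.
have [_ _ cH] := mixed_dihedral_card XYn.
split; first exact: join_decomp XH YH defH (der_normal 1 H) (der_abelian 0 H).
exact: join_disj XH YH defH (der_normal 1 H) (der_abelian 0 H) cH.
Qed.

(** * The quotient of a frame by the derived subgroup *)

Section FrameToCover.
Variables (Gm : sgraph) (H N : {group {perm Gm}}) (u v : Gm) (n : nat).
Hypotheses (F : edge_frame H u v) (Gm_conn : connected_graph Gm).
Hypotheses (XYn : mixed_dihedral H 'C_H[u | 'P] 'C_H[v | 'P] n).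
Hypothesis defN : H^`(1) = N.

Let nNH : N <| H.
Proof. by rewrite -defN der_normal. Qed.

Let NH z : z \in N -> z \in H.
Proof. exact/subsetP/normal_sub. Qed.

(** Write h = x y z: x fixes u and z in N preserves orbits. The orbits on the side of u are thus
    indexed by the stabiliser of v. *)
Lemma frame_qvert h : h \in H ->
  exists2 y, y \in 'C_H[v | 'P] & qvert N (h u) = qvert N (y u).
Proof.
have [dec _] := mixed_dihedral_join XYn.
case/dec=> x [y [z [+ yY zN ->]]]; rewrite defN in zN.
rewrite mem_stab => /andP[_ /eqP xu].
by exists y => //; rewrite !permM xu qvert_act.
Qed.

Lemma frame_qvert_inj : {in 'C_H[v | 'P] &, injective (fun y : {perm Gm} => qvert N (y u))}.
Proof.
have [_ disj] := mixed_dihedral_join XYn.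
move=> y y' yY yY' /eqP/qvertP[z zN] zy.
have yH : y \in H by case/setIP: yY.
have yH' : y' \in H by case/setIP: yY'.
(* This element of X is also y' y^-1 times a conjugate of z, hence in YN, where X meets it
   trivially. *)
have xX : y' * z * y^-1 \in 'C_H[u | 'P].
  by rewrite mem_stab !groupM ?groupV ?(NH zN) //= !permM zy permK eqxx.
have yyY : y' * y^-1 \in 'C_H[v | 'P] by rewrite groupM ?groupV.
have zyN : z ^ y^-1 \in H^`(1).
  by rewrite defN memJ_norm // groupV (subsetP (normal_norm nNH)).
have [|_ /eqP] := disj _ _ _ xX yyY zyN; first by rewrite conjgE invgK !mulgA mulgKV.
by rewrite -eq_mulgV1 eq_sym => /eqP.
Qed.

Lemma frame_qvert_sides g h : g \in H -> h \in H -> qvert N (g u) != qvert N (h v).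
Proof.
move=> gH hH; rewrite eq_sym; apply/qvertP=> -[z zN zg].
have := frame_sides F (groupM (groupM gH (NH zN)) (groupVr hH)).
by rewrite !permM zg permK eqxx.
Qed.

(** The element y x takes v to x v, and it takes u into the orbit of y u because it differs from x y
    by a commutator, which lies in N. *)
Lemma frame_qvert_adj x y : x \in 'C_H[u | 'P] -> y \in 'C_H[v | 'P] ->
  adj (qvert N (y u)) (qvert N (x v)).
Proof.
rewrite !mem_stab => /andP[xH /eqP xu] /andP[yH /eqP yv].
have -> : qvert N (y u) = qvert N ((y * x) u).
  have cN : [~ y, x] \in N by rewrite -defN; apply: mem_commg.
  by rewrite commgC permM (qvert_act _ cN) permM xu.
apply: adj_qvert; last by rewrite frame_qvert_sides ?groupM.
by rewrite -{1}yv -permM (frame_adjE F) ?groupM // (frame_adj F).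
Qed.

Lemma frame_not_adj g h : g \in H -> h \in H -> ~~ adj (g u) (h u).
Proof.
move=> gH hH; apply/negP=> /(frame_trans F)[k kH] /set2_inj[][_ E].
  by have := frame_sides F (groupM hH (groupVr kH)); rewrite permM -E permK eqxx.
by have := frame_sides F (groupM gH (groupVr kH)); rewrite permM -E permK eqxx.
Qed.

Lemma frame_qvert_not_adj g h : g \in H -> h \in H ->
  ~~ adj (qvert N (g u)) (qvert N (h u)).
Proof.
move=> gH hH; apply/negP.
have N_aut := subset_trans (normal_sub nNH) (frame_aut F).
case/(adj_qvert_lift N_aut)=> z gz /eqP; rewrite eq_sym => /qvertP[m mN hm].
have := frame_not_adj gH (groupM hH (groupVr (NH mN))).
by rewrite permM -hm permK gz.
Qed.

Lemma frame_valency_stab h : h \in H -> #|[set y | adj (h u) y]| = (2 ^ n)%N.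
Proof.
move=> hH; have [<- _ _] := mixed_dihedral_card XYn.
rewrite (frame_card_stab F) -[RHS](card_imset _ (@perm_inj _ h)).
apply: eq_card => y; rewrite inE -[y](permKV h) mem_imset; last exact: perm_inj.
by rewrite (frame_adjE F) // inE.
Qed.

End FrameToCover.

Lemma graph_isomorphic_sym (K L : sgraph) :
  graph_isomorphic K L -> graph_isomorphic L K.
Proof.
case=> f [[g fK gK] fadj]; exists g; split; first by exists f.
by move=> x y; rewrite -fadj !gK.
Qed.

Lemma path_set2_inj (T : finType) (p q r a b c : T) :
  [set p; q] = [set a; b] -> [set q; r] = [set b; c] -> a != c ->
  [/\ p = a, q = b & r = c].
Proof.
move=> /set2_inj[[-> ->]|[-> ->]] /set2_inj[[E1 E2]|[E1 E2]]; rewrite ?E1 ?E2 ?eqxx //.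
Qed.

Section FrameCover.
Variables (Gm : sgraph) (H N : {group {perm Gm}}) (u v : Gm) (n : nat).
Hypotheses (F : edge_frame H u v) (Gm_conn : connected_graph Gm).
Hypotheses (XYn : mixed_dihedral H 'C_H[u | 'P] 'C_H[v | 'P] n).
Hypothesis defN : H^`(1) = N.

Let F' := frame_sym F.
Let YXn := mixed_dihedral_sym XYn.

Lemma frame_valency : has_valency (2 ^ n) Gm.
Proof.
move=> w; have [h hH [->|->]] := frame_vertex F Gm_conn w.
  exact: frame_valency_stab F XYn h hH.
exact: frame_valency_stab F' YXn h hH.
Qed.

Lemma frame_quotient :
  graph_isomorphic (normal_quotient N) (complete_bipartite (2 ^ n) (2 ^ n)).
Proof.
have [cX cY _] := mixed_dihedral_card XYn.
pose x_ (j : 'I_(2 ^ n)) : {perm Gm} := enum_val (cast_ord (esym cX) j).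
pose y_ (i : 'I_(2 ^ n)) : {perm Gm} := enum_val (cast_ord (esym cY) i).
have xX j : x_ j \in 'C_H[u | 'P] by apply: enum_valP.
have yY i : y_ i \in 'C_H[v | 'P] by apply: enum_valP.
have xH j : x_ j \in H by have /setIP[] := xX j.
have yH i : y_ i \in H by have /setIP[] := yY i.
have x_inj : injective x_ by move=> i j /enum_val_inj/cast_ord_inj.
have y_inj : injective y_ by move=> i j /enum_val_inj/cast_ord_inj.
have x_onto x : x \in 'C_H[u | 'P] -> exists j, x_ j = x.
  move=> xX'; exists (cast_ord cX (enum_rank_in xX' x)).
  by rewrite /x_ cast_ordK enum_rankK_in.
have y_onto y : y \in 'C_H[v | 'P] -> exists i, y_ i = y.
  move=> yY'; exists (cast_ord cY (enum_rank_in yY' y)).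
  by rewrite /y_ cast_ordK enum_rankK_in.
apply: graph_isomorphic_sym.
pose f (a : complete_bipartite (2 ^ n) (2 ^ n)) : normal_quotient N :=
  match a with inl i => qvert N (y_ i u) | inr j => qvert N (x_ j v) end.
have sides := frame_qvert_sides F defN.
exists f; split; [apply: inj_surj_bij|].
- case=> i [] j /= E.
  + by congr inl; apply: y_inj; apply: (frame_qvert_inj XYn defN) E.
  + by have := sides _ _ (yH i) (xH j); rewrite E eqxx.
  + by have := sides _ _ (yH j) (xH i); rewrite E eqxx.
  by congr inr; apply: x_inj; apply: (frame_qvert_inj YXn defN) E.
- move=> B; have [w ->] := qvert_surj B.
  have [h hH [->|->]] := frame_vertex F Gm_conn w.
    have [y /y_onto[i <-] ->] := frame_qvert XYn defN hH.
    by exists (inl i); rewrite /= eqxx.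
  have [x /x_onto[j <-] ->] := frame_qvert YXn defN hH.
  by exists (inr j); rewrite /= eqxx.
case=> i [] j; rewrite /f.
- exact/negbTE/(frame_qvert_not_adj F defN).
- exact: (frame_qvert_adj F defN).
- by rewrite adj_sym; apply: (frame_qvert_adj F defN).
exact/negbTE/(frame_qvert_not_adj F' defN).
Qed.

Lemma frame_quotient_valency : has_valency (2 ^ n) (normal_quotient N).
Proof. exact: iso_valency frame_quotient (@complete_bipartite_valency _). Qed.

Variable G : {group {perm Gm}}.
Hypotheses (nHG : H <| G) (G_aut : G \subset graph_aut Gm) (n_gt0 : (0 < n)%N).

Let HG h : h \in H -> h \in G.
Proof. exact/subsetP/normal_sub. Qed.

Lemma frame_base_2arc : exists2 x, x \in 'C_H[u | 'P] & is_2arc v u (x v).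
Proof.
have [cX _ _] := mixed_dihedral_card XYn.
have : 'C_H[u | 'P] :!=: 1 by rewrite trivg_card1 cX -(expn0 2) eqn_exp2l // -lt0n.
case/trivgPn=> x xX x1; exists x => //; apply/and3P; split.
- apply: contra x1 => /eqP xv; apply/eqP/(frame_fix_inj F) => //.
  by rewrite perm1.
- by rewrite adj_sym (frame_adj F).
by have : x v \in [set a | adj u a]; [rewrite (frame_nbrs F) imset_f | rewrite inE].
Qed.

(** Edge-transitivity on the line graph moves the base 2-arc (v, u, x v) to any other up to
    reversal, and the involution x fixes u while swapping v and x v. *)
Lemma frame_two_arc_transitive :
  edge_transitive (line_action Gm) G -> two_arc_transitive G.
Proof.
move=> Gtr; split=> //; have [x xX vux] := frame_base_2arc.
have /and3P[vx vu ux] := vux.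
have [xH xu] : x \in H /\ x u = u by move: xX; rewrite mem_stab => /andP[? /eqP].
have xx : x (x v) = v.
  have [_ [+ _] _ _] := XYn; rewrite isog_C2pow => /andP[+ _].
  case/(abelemP (isT : prime 2)) => _ /(_ x xX) x2.
  by rewrite -permM -[x * x]/(x ^+ 2) x2 perm1.
have base a b c : is_2arc a b c ->
    exists2 g, g \in G & [/\ g v = a, g u = b & g (x v) = c].
  move=> /and3P[ac ab bc].
  have [g gG gE] := edge_transitive_elim Gtr (line_adj_intro vu ux vx)
    (line_adj_intro ab bc ac).
  have gA := subsetP G_aut g gG.
  have [[/(congr1 val) + /(congr1 val)]|[/(congr1 val) + /(congr1 val)]] := set2_inj gE;
    rewrite !line_actionE //= !imset_set2 => E1 E2.
    by exists g => //; apply: path_set2_inj.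
  exists (x * g); first by rewrite groupM ?(HG xH).
  by rewrite !permM xx xu; apply: (path_set2_inj _ _ ac); rewrite setUC.
move=> a b c a' b' c' /base[g gG [<- <- <-]] /base[g' gG' [<- <- <-]].
by exists (g^-1 * g'); rewrite ?groupM ?groupV // !permM !permK.
Qed.

(** The valency is at least 2, so every vertex is the middle of a 2-arc. *)
Lemma frame_vertex_transitive : two_arc_transitive G ->
  [transitive G, on [set: Gm] | 'P].
Proof.
move=> [_ Gtr]; have [x xX vux] := frame_base_2arc.
apply/imsetP; exists u => //; apply/esym/setP=> w; rewrite inE.
have : (1 < #|[set y | adj w y]|)%N by rewrite frame_valency -(expn0 2) ltn_exp2l.
case/card_gt1P=> a [b [+ + ab]]; rewrite !inE => wa wb.
have awb : is_2arc a w b by rewrite /is_2arc ab adj_sym wa.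
by have [g gG [_ gu _]] := Gtr _ _ _ _ _ _ vux awb; apply/orbitP; exists g.
Qed.

Lemma frame_edge_affine : N <| G ->
  edge_affine n (normal_quotient_action N) (G / N)%G.
Proof.
move=> nNG.
have N_aut := subset_trans (normal_sub nNG) G_aut.
have nN g : g \in G -> g \in 'N(N) by apply/subsetP/normal_norm.
have NG z : z \in N -> z \in G by apply/subsetP/normal_sub.
have nNH : N <| H by rewrite -defN der_normal.
have NH z : z \in N -> z \in H by apply/subsetP/normal_sub.
have val_Gm := frame_valency; have val_q := frame_quotient_valency.
have cov := cover_adj N_aut val_Gm val_q.
have fib := cover_edge_fibre N_aut val_Gm val_q.
have Gadj g a b : g \in G -> adj (g a) (g b) = adj a b.
  by move=> gG; have /sub_graph_autP -> := subsetP G_aut g gG.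
have auts : acts_as_auts (normal_quotient_action N) (G / N).
  split; first by apply/subsetP=> _ /morphimP[g gN _ ->]; apply: quotient_action_dom.
  have mono g x y : g \in G -> adj (qvert N x) (qvert N y) ->
      adj (qvert N (g x)) (qvert N (g y)).
    move=> gG /(adj_qvert_lift N_aut)[z xz zy].
    rewrite -(quotient_actionE y) ?nN // -zy quotient_actionE ?nN //.
    by apply: cov; rewrite Gadj.
  move=> _ /morphimP[g gN gG ->] B C; have [x ->] := qvert_surj B.
  have [y ->] := qvert_surj C; rewrite !quotient_actionE //.
  apply/idP/idP; last exact: mono.
  by move/(mono g^-1 _ _ (groupVr gG)); rewrite !permK.
split=> //.
  (* Faithfulness: g agrees at u with some z in N, and g z^-1 fixes u and every orbit, so it is
     trivial. *)
  apply/subsetP=> _ /setIP[/morphimP[g gN gG ->] gC]; apply/set1P/coset_id.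
  have gq y : qvert N (g y) = qvert N y.
    by rewrite -quotient_actionE //; apply: (astab_act gC); rewrite inE.
  have /eqP/qvertP[z zN zu] := gq u.
  have : g * z^-1 = 1.
    have zV : z^-1 \in N by rewrite groupV.
    apply: (cover_fix N_aut Gm_conn val_Gm val_q (x := u)).
    - by apply: (subsetP G_aut); rewrite groupM ?(NG _ zV).
    - by rewrite permM -zu permK.
    by move=> y; rewrite permM qvert_act.
  by move/eqP; rewrite -eq_mulgV1 => /eqP->.
have [cX cY cHN] := mixed_dihedral_card XYn.
have [_ _ _] := XYn; rewrite defN => HNiso.
exists (H / N)%G; split.
- by apply: quotient_normal.
- by rewrite isog_C2pow_setX -isog_C2pow.
- apply/negP=> Htr.
  have := atransP2in _ Htr (in_setT (qvert N u)) (in_setT (qvert N v)).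
  case=> [|_ /morphimP[h hN hH ->]].
    by have [+ _] := auts; apply: subset_trans; rewrite quotientS ?normal_sub.
  rewrite quotient_actionE // => /eqP; rewrite eq_sym; apply/negP.
  by have := frame_qvert_sides F defN hH (group1 H); rewrite perm1.
split.
  apply: edge_transitive_intro (cov _ _ (frame_adj F)) _.
    have [sub Ladj] := auts; split.
      by apply: subset_trans sub; rewrite quotientS ?normal_sub.
    by move=> a aH; apply: Ladj; apply: subsetP a aH; rewrite quotientS ?normal_sub.
  move=> C D; have [c ->] := qvert_surj C; have [d' ->] := qvert_surj D.
  move=> /(adj_qvert_lift N_aut)[d cd <-].
  have [h hH E] := frame_trans F cd; exists (coset N h); first exact: mem_quotient.
  rewrite !quotient_actionE ?nN ?HG //.
  by case: (set2_inj E) => [] [-> ->] //; rewrite setUC.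
move=> E /edgesP[A [B [+ ->]]]; have [a ->] := qvert_surj A; have [b' ->] := qvert_surj B.
move=> /(adj_qvert_lift N_aut)[b ab <-].
apply/trivgP/subsetP=> _ /setIP[/morphimP[h hN hH ->] hE].
have := astab_act hE (set11 _); rewrite setact_set2 !quotient_actionE //.
(* If h fixes an edge of the quotient, then some z in N makes h z fix the edge {a,b} of the graph
   above it. *)
move=> /set2_inj hq; have [z zN zE] : exists2 z, z \in N & [set z (h a); z (h b)] = [set a; b].
  have hab : adj (h a) (h b) by rewrite Gadj ?HG.
  case: hq => [][ha hb].
    by have [z zN [za zb]] := fib _ _ _ _ hab ab (esym ha) (esym hb); exists z; rewrite ?za ?zb.
  rewrite adj_sym in ab.
  by have [z zN [za zb]] := fib _ _ _ _ hab ab (esym ha) (esym hb);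
    exists z; rewrite ?za ?zb // setUC.
have [k kH kE] := frame_trans F ab.
have hzH : h * z \in H by rewrite groupM ?(NH z zN).
have hzE : [set z (h (k u)); z (h (k v))] = [set k u; k v].
  by case: (set2_inj kE) => [] [-> ->]; rewrite // setUC zE setUC.
(* Conjugation moves the fixed edge back to {u,v}, where [frame_free] applies; so h = z^-1 lies in
   N. *)
have : (h * z) ^ k^-1 == 1.
  apply/eqP/(frame_free F); first by rewrite groupJ ?groupV.
  rewrite conjgE invgK !permM; have := congr1 (fun A : {set Gm} => k^-1 @: A) hzE.
  by rewrite /= !imset_set2 !permK.
rewrite conjg_eq1 -[z]invgK -eq_mulgV1 => /eqP ->.
by apply/set1P/coset_id; rewrite groupV.
Qed.

End FrameCover.

Theorem theorem1p6 (n : nat) (Sigma : sgraph) (G N : {group {perm Sigma}})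
    (n_ge2 : (2 <= n)%N) (Sigma_conn : connected_graph Sigma)
    (G_aut : G \subset graph_aut Sigma) (N_normal : N <| G) :
  [/\ two_arc_transitive G,
      normal_cover G N (complete_bipartite (2 ^ n)%N (2 ^ n)%N)
    & edge_affine n (normal_quotient_action N) (G / N)%G]
  <->
  (exists H : {group {perm Sigma}},
    [/\ H <| G,
        H^`(1) = N
      & exists X Y : {group {perm Sigma}},
        [/\ mixed_dihedral H X Y n,
            line_graph_is_mixed_dihedral H X Y
          & edge_transitive (line_action Sigma) G]]).
Proof.
have n_gt0 : (0 < n)%N by apply: ltnW.
split=> [[G2tr [Gtr Qiso [k [Gm_k K_k]]] [_ _ [M [nMG Miso Mintr Mreg]]]]|].
  have m_gt0 : (0 < 2 ^ n)%N by rewrite expn_gt0.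
  have km := has_valency_inj (inl (Ordinal m_gt0) : complete_bipartite (2 ^ n) (2 ^ n))
    K_k (@complete_bipartite_valency _).
  subst k; have Q_m := iso_valency Qiso K_k.
  (* H is the full preimage in G of the edge-regular subgroup M. *)
  have [H MH NH nHG] := inv_quotientN N_normal nMG.
  have nNH : N <| H := normalS NH (normal_sub nHG) N_normal.
  have H_aut := subset_trans (normal_sub nHG) G_aut.
  rewrite MH in Mintr Mreg; move: Miso; rewrite isog_C2pow_setX MH.
  case/andP=> abHN /eqP cHN.
  have [u _ _] := imsetP Gtr.
  have [v uv] := valency_nbr u Gm_k m_gt0.
  have F := cover_frame Sigma_conn H_aut nNH m_gt0 Gm_k Q_m Mintr Mreg uv.
  have tiN w := cover_stab_TI Sigma_conn H_aut nNH Gm_k Q_m w.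
  have [XYn defN] : mixed_dihedral H 'C_H[u | 'P] 'C_H[v | 'P] n /\ H^`(1) = N.
    apply: mixed_dihedral_of_quotient => //; rewrite ?subsetIl ?tiN //.
    - exact: frame_gen F Sigma_conn.
    - by rewrite (frame_card_stab F).
    by rewrite (frame_card_stab (frame_sym F)).
  exists H; split=> //; exists 'C_H[u | 'P]%G, 'C_H[v | 'P]%G; split=> //.
    exact: frame_line_graph.
  have [x _ vux] := frame_base_2arc F XYn n_gt0.
  exact: two_arc_line_transitive G2tr vux.
case=> H [nHG defN [X [Y [XYn XYline Gtr]]]].
have H_aut := subset_trans (normal_sub nHG) G_aut.
have [[XH YH] _ _ _] := XYn; have [cX cY _] := mixed_dihedral_card XYn.
have [_ disj] := mixed_dihedral_join XYn.
have tXY : X :&: Y = 1.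
  apply/trivgP/subsetP=> z /setIP[zX zY]; apply/set1P.
  by have [] := disj z z 1 zX zY (group1 _) (esym (mulg1 z)).
have nontriv (Z : {group {perm Sigma}}) : #|Z| = (2 ^ n)%N -> Z :!=: 1.
  by move=> cZ; rewrite trivg_card1 cZ -(expn0 2) eqn_exp2l // -lt0n.
have [u [v [F CX CY]]] :=
  line_graph_frame H_aut XH YH tXY (nontriv X cX) (nontriv Y cY) XYline.
have {}XYn : mixed_dihedral H 'C_H[u | 'P] 'C_H[v | 'P] n.
  by rewrite (group_inj CX) (group_inj CY).
have G2tr := frame_two_arc_transitive F XYn nHG G_aut n_gt0 Gtr.
have Eaff := frame_edge_affine F Sigma_conn XYn defN nHG G_aut N_normal.
split=> //; split.
- exact: frame_vertex_transitive F Sigma_conn XYn _ n_gt0 G2tr.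
- exact: frame_quotient F Sigma_conn XYn defN.
exists (2 ^ n)%N; split; last exact: complete_bipartite_valency.
exact: frame_valency F Sigma_conn XYn.
Qed.
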